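(* Let $d\ge1$ and $\rho>d+1$. Let $(X,Y)$ be an $\mathbb R^d\times\mathbb R^d$-valued martingale coupling (i.e. $\mathbb E[Y|X]=X$) with law $\mathbb P_0$, such that $\mathbb E[|(X,Y)|_2^{2(d+1)+\delta}]<\infty$ for some $\delta>0$, and suppose it is non-degenerate, i.e. $\mathbb P_0(X=Y)<1$. For $\sigma>0$ let $\{G_x\}_{x\in\mathbb R^d}$ (depending on $\sigma$) be a centered $\mathbb R^d$-valued Gaussian process with covariance $$\mathbb E[G_xG_y^\top]=\mathbb E[(Y-X)f_{\xi,\rho,\sigma}(x-X)f_{\xi,\rho,\sigma}(y-X)(Y-X)^\top],\qquad x,y\in\mathbb R^d.$$ Then $$\mathbb E\Big[\int_{\mathbb R^d}|G_x|_2\,dx\Big]\asymp 1\quad\text{as }\sigma\to\infty,$$ i.e. there is a constant $C>0$ (independent of $\sigma$) such that $1/C\le\mathbb E[\int|G_x|_2\,dx]\le C$ for all sufficiently large $\sigma$.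
   Context: $|\cdot|_2$ is the Euclidean norm, and $$f_{\xi,\rho,\sigma}(x)=\sigma^{-d}C_\rho\Big(\frac{|x|_2}{\sigma}+1\Big)^{-\rho},\qquad x\in\mathbb R^d,\qquad C_\rho^{-1}=\int_{\mathbb R^d}(|x|_2+1)^{-\rho}\,dx.$$ *)

(* Defs.v *)
(* R^d is modelled by d.-tuple R, which carries the product (= Borel)
   sigma-algebra. *)
From HB Require Import structures.
From mathcomp Require Import all_boot all_order all_algebra.
From mathcomp Require Import all_classical all_reals all_analysis.
Import Order.TTheory GRing.Theory Num.Theory.
Import numFieldNormedType.Exports.

Set Implicit Arguments.
Unset Strict Implicit.
Unset Printing Implicit Defensive.

Local Open Scope classical_set_scope.
Local Open Scope ring_scope.

Section lebesgue_measure_tuple.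
Context {R : realType}.

Section cons.
Context {n : nat}.

Definition tcons (p : measurableTypeR R * n.-tuple R) : n.+1.-tuple R :=
  [the n.+1.-tuple R of p.1 :: p.2].

Lemma measurable_tcons : measurable_fun setT tcons.
Proof. by apply: measurable_cons; [exact: measurable_fst|exact: measurable_snd]. Qed.

Lemma measurable_tuncons :
  measurable_fun setT (fun t : n.+1.-tuple R =>
    (thead t, [tuple of behead t]) : measurableTypeR R * n.-tuple R).
Proof.
apply/measurable_fun_pair => /=; last exact: measurable_behead.
exact: measurable_tnth.
Qed.

Variable mu : {sigma_finite_measure set (n.-tuple R) -> \bar R}.

Definition lebesgue_tcons : set (n.+1.-tuple R) -> \bar R :=
  pushforward (@lebesgue_measure R \x mu)%E tcons.

Let lebesgue_tcons0 : lebesgue_tcons set0 = 0%E.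
Proof. by rewrite /lebesgue_tcons /pushforward preimage_set0 measure0. Qed.

Let lebesgue_tcons_ge0 A : (0 <= lebesgue_tcons A)%E.
Proof. by rewrite /lebesgue_tcons /pushforward measure_ge0. Qed.

Let lebesgue_tcons_sigma_additive : semi_sigma_additive lebesgue_tcons.
Proof.
rewrite /lebesgue_tcons; pose h := measurable_tcons.
exact: (@measure_semi_sigma_additive _ _ _
  (measure_function_pushforward__canonical__measure_function_Measure _ h)).
Qed.

HB.instance Definition _ := isMeasure.Build _ _ _ lebesgue_tcons
  lebesgue_tcons0 lebesgue_tcons_ge0 lebesgue_tcons_sigma_additive.

Lemma lebesgue_tcons_sigma_finite : sigma_finite setT lebesgue_tcons.
Proof.
have /sigma_finiteP[F [TF ndF Foo]] := sigma_finiteT (@lebesgue_measure R).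
have /sigma_finiteP[G [TG ndG Goo]] := sigma_finiteT mu.
pose u (t : n.+1.-tuple R) : measurableTypeR R * n.-tuple R :=
  (thead t, [tuple of behead t]).
exists (fun k => u @^-1` (F k `*` G k)).
  apply/esym; rewrite -subTset => t _.
  have [k _ Fk] : (\bigcup_k F k) (thead t) by rewrite -TF.
  have [l _ Gl] : (\bigcup_k G k) [tuple of behead t] by rewrite -TG.
  exists (maxn k l) => //; split => /=.
    by move: Fk; exact/subsetPset/ndF/leq_maxl.
  by move: Gl; exact/subsetPset/ndG/leq_maxr.
move=> k; have [mF Flt] := Foo k; have [mG Glt] := Goo k; split.
  by rewrite -[_ @^-1` _]setTI; apply: measurable_tuncons => //;
    exact: measurableX.
rewrite /lebesgue_tcons /pushforward -comp_preimage (_ : u \o tcons = id).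
  by rewrite preimage_id product_measure1E// lte_mul_pinfty// ge0_fin_numE.
by apply/funext => -[x t]; congr pair; apply/val_inj.
Qed.

HB.instance Definition _ := Measure_isSigmaFinite.Build _ _ _
  lebesgue_tcons lebesgue_tcons_sigma_finite.

End cons.

(* d-dimensional Lebesgue measure, as the iterated product of the
   one-dimensional one (for d = 0, the unit mass at the empty tuple). *)
Fixpoint lebesgue_measure_tuple (d : nat) :
    {sigma_finite_measure set (d.-tuple R) -> \bar R} :=
  if d is n.+1 then lebesgue_tcons (lebesgue_measure_tuple n)
  else \d_[tuple].

Lemma lebesgue_measure_tuple_box (d : nat) (A : 'I_d -> set R) :
  (forall i, measurable (A i)) ->
  lebesgue_measure_tuple d [set t | forall i, A i (tnth t i)] =
  (\prod_(i < d) lebesgue_measure (A i))%E.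
Proof.
elim: d A => [|d ih] A mA /=.
  by rewrite big_ord0 diracE mem_set// => -[].
rewrite big_ord_recl -ih// /lebesgue_tcons /pushforward -product_measure1E//.
  congr (_ _); apply/seteqP; split=> -[x t]/= => [h|[A0 h] i].
    split=> [|i]; first exact: (h ord0).
    by have := h (lift ord0 i); rewrite tnthS.
  by have [j ->|->] := unliftP ord0 i; first by rewrite tnthS; exact: h.
  exact: (mA ord0).
rewrite (_ : mkset _ =
    \bigcap_(i in [set: 'I_d]) ((fun t => tnth t i) @^-1` A (lift ord0 i))).
  apply: fin_bigcap_measurable => [|i _]; first exact: finite_finset.
  by rewrite -[X in measurable X]setTI; apply: measurable_tnth => //; exact: mA.
by apply/seteqP; split=> t /= h i => [_|]; exact: h.
Qed.

End lebesgue_measure_tuple.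

Section euclidean.
Context {R : realType} {d : nat}.
Implicit Types x y : d.-tuple R.

Definition enorm x : R := Num.sqrt (\sum_(i < d) tnth x i ^+ 2).

Definition vsub x y : d.-tuple R := [tuple tnth x i - tnth y i | i < d].

End euclidean.

Section smoothing_density.
Context {R : realType}.

(* The C_rho of the density: the inverse of the integral of (|x| + 1)^(-rho). *)
Definition density_const (d : nat) (rho : R) : R :=
  (\int[lebesgue_measure_tuple d]_x (enorm x + 1) `^ (- rho))^-1.

Definition smoothing_density (d : nat) (rho sigma : R) (x : d.-tuple R) : R :=
  sigma ^- d * density_const d rho * (enorm x / sigma + 1) `^ (- rho).

End smoothing_density.

Section conditional_expectation.
Context {dT dS : measure_display} {T : measurableType dT} {S : measurableType dS}
  {R : realType}.
Variable P : probability T R.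

(* W is a version of the conditional expectation of Z given the
   sigma-algebra generated by X. *)
Definition is_cond_exp (X : T -> S) (Z W : T -> R) : Prop :=
  [/\ P.-integrable setT (EFin \o Z),
      P.-integrable setT (EFin \o W),
      (forall A : set R, measurable A ->
        preimage_set_system setT X measurable (W @^-1` A)) &
      forall B : set S, measurable B ->
        (\int[P]_(w in X @^-1` B) (W w)%:E =
         \int[P]_(w in X @^-1` B) (Z w)%:E)%E].

End conditional_expectation.

(* E[Y | X] = X, componentwise. *)
Definition martingale_coupling {dT : measure_display} {T : measurableType dT}
    {R : realType} (P : probability T R) (d : nat) (X Y : T -> d.-tuple R) : Prop :=
  forall i : 'I_d,
    is_cond_exp P X (fun w => tnth (Y w) i) (fun w => tnth (X w) i).

Section gaussian.
Context {dT : measure_display} {T : measurableType dT} {R : realType}.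
Variable P : probability T R.

(* normal_prob m 0 is not the point mass at m (it is a placeholder law), so
   the degenerate case is treated separately. *)
Definition gaussian_law (m s : R) (A : set R) : \bar R :=
  if s == 0 then \d_m A else normal_prob m s A.

Definition gaussian_var (Z : T -> R) : Prop :=
  measurable_fun setT Z /\
  exists m s : R, 0 <= s /\
    forall A : set R, measurable A -> P (Z @^-1` A) = gaussian_law m s A.

(* All finite-dimensional marginals are jointly Gaussian: every linear
   combination of finitely many coordinates is Gaussian. *)
Definition gaussian_process (I : Type) (d : nat)
    (G : I -> T -> d.-tuple R) : Prop :=
  forall (n : nat) (t : 'I_n -> I) (a : 'I_n -> d.-tuple R),
    gaussian_var (fun w =>
      \sum_(k < n) \sum_(i < d) tnth (a k) i * tnth (G (t k) w) i).

Definition centered_process (I : Type) (d : nat)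
    (G : I -> T -> d.-tuple R) : Prop :=
  forall (x : I) (i : 'I_d), ('E_P[fun w => tnth (G x w) i] = 0)%E.

(* Joint measurability in (x, w), which gives a meaning to the expectation of
   the integral of the process over R^d. *)
Definition measurable_process (d : nat)
    (G : d.-tuple R -> T -> d.-tuple R) : Prop :=
  measurable_fun [set: d.-tuple R * T] (fun p => G p.1 p.2).

End gaussian.

(* Main.v *)
Require Import Defs.
From mathcomp Require Import all_boot all_order all_algebra.
From mathcomp Require Import all_classical all_reals all_analysis.
From mathcomp Require Import measurable_realfun ring lra.
Import Order.TTheory GRing.Theory Num.Theory.
Import numFieldNormedType.Exports.

Set Implicit Arguments.
Unset Strict Implicit.
Unset Printing Implicit Defensive.

Local Open Scope classical_set_scope.
Local Open Scope ring_scope.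

(** By Tonelli the quantity is the integral over x of E|G_x|, so it is enough to
    control E|G_x| pointwise, and this first absolute moment is comparable to
    the standard deviation.  The upper bound E|Z| <= b whenever E[Z^2] <= b^2
    holds for any Z ([abs_moment_le]); the converse is where Gaussianity enters
    ([gaussian_abs_moment_ge]): a Gaussian of scale s gives mass at most 1/2 to
    the ball of radius s/2, so E|Z| >= s/4, while a centered one has second
    moment at most 8 s^2.

    The i-th coordinate of G_x has variance v_i(x) = E[(Y_i-X_i)^2 f(x-X)^2],
    and f has height of order sigma^(-d) and width of order sigma.

    Upper bound ([smoothed_variance_le]).  Since |x| is at most a constant times
    |x-X| + |X|, for sigma >= 1 the factor (|x-X|/sigma + 1)^(-q) is at most a
    constant times (|x|/sigma + 1)^(-q) (|X| + 1)^q, which moves the dependence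
    on X into the expectation.  This needs the moment E[(Y_i-X_i)^2 (|X|+1)^(2q)],
    hence 2q + 2 moments of (X,Y), so rho is first lowered to
    q = min(rho, d + delta/2); this is still larger than d, and therefore
    sigma^(-d) times the integral of (|x|/sigma + 1)^(-q) is bounded
    ([integral_enorm_decay]).  That integral is bounded by a product of
    one-dimensional ones because |x| dominates every |x_i|.

    Lower bound ([smoothed_variance_ge]).  On the cube [0,sigma]^d, of volume
    sigma^d, the density f(x-X) is at least sigma^(-d) times a strictly positive
    function of X that depends neither on x nor on sigma.  As X and Y differ with
    positive probability, some coordinate Y_i-X_i does too
    ([increment_weighted_gt0]), so the standard deviation of that coordinate of
    G_x is at least a positive constant times sigma^(-d) throughout the cube. *)

(** * Moments of Gaussian variables *)

(** Uniqueness of Radon-Nikodym derivatives identifies the one chosen by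
    [change_of_variables] with the explicit Gaussian density. *)
Lemma ge0_integral_normal_prob (R : realType) (m s : R) (f : R -> \bar R) :
  measurable_fun [set: R] f -> (forall x, (0 <= f x)%E) ->
  (\int[normal_prob m s]_x f x =
   \int[lebesgue_measure]_x (f x * (normal_pdf m s x)%:E))%E.
Proof.
move=> mf f0; have dom := normal_prob_dominates m s.
rewrite -(Radon_Nikodym_SigmaFinite.change_of_variables dom)//.
apply: ae_eq_integral => //.
- apply: emeasurable_funM => //.
  exact: measurable_int (Radon_Nikodym_SigmaFinite.f_integrable dom).
- apply: emeasurable_funM => //; apply/measurable_EFinP.
  exact: measurable_normal_pdf.
- apply: ae_eqe_mul2l.
  apply: integral_ae_eq => //.
  + exact: Radon_Nikodym_SigmaFinite.f_integrable.
  + by apply/measurable_EFinP; exact: measurable_normal_pdf.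
  + by move=> E _ mE; rewrite -Radon_Nikodym_SigmaFinite.f_integral.
Qed.

(** Doubling the scale of a Gaussian density turns the exponential factor
    exp(-4u) into exp(-u), and the gain exp(3u) absorbs the factor 2u.  This
    bounds the second moment by the total mass of another Gaussian, without
    integrating by parts. *)
Lemma normal_pdf_sqr_le (R : realType) (m s x : R) : 0 < s ->
  (x - m) ^+ 2 * normal_pdf m s x <= 8 * s ^+ 2 * normal_pdf m (2 * s) x.
Proof.
move=> s0; have s20 : 0 < 2 * s by rewrite mulr_gt0.
rewrite !normal_pdfE ?gt_eqF//.
have -> : normal_peak s = 2 * normal_peak (2 * s).
  rewrite /normal_peak (_ : (2 * s) ^+ 2 * pi *+ 2 = 2 ^+ 2 * (s ^+ 2 * pi *+ 2)); last by ring.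
  rewrite [in RHS]sqrtrM ?exprn_ge0// sqrtr_sqr ger0_norm// invfM mulrA divff ?mul1r//.
(* the exponent at scale 2s; at scale s it is 4u *)
set u := (x - m) ^+ 2 / (s ^+ 2 *+ 8).
have u0 : 0 <= u by rewrite divr_ge0 ?sqr_ge0// mulrn_wge0// sqr_ge0.
have s2 : s ^+ 2 != 0 by rewrite expf_neq0 ?gt_eqF.
have -> : (x - m) ^+ 2 = 8 * s ^+ 2 * u by rewrite /u; field; rewrite gt_eqF.
have -> : normal_fun m s x = expR (- (4 * u)).
  by rewrite /normal_fun /u; congr expR; field; rewrite gt_eqF.
have -> : normal_fun m (2 * s) x = expR (- u).
  by rewrite /normal_fun /u; congr expR; field; rewrite gt_eqF.
have p0 := normal_peak_gt0 (lt0r_neq0 s20).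
have ->: 8 * s ^+ 2 * u * (2 * normal_peak (2 * s) * expR (- (4 * u))) =
   8 * s ^+ 2 * (normal_peak (2 * s) * (2 * u * expR (- (4 * u)))) by ring.
rewrite ler_wpM2l ?mulr_ge0 ?(ltW s0)// ler_wpM2l ?(ltW p0)//.
have -> : - (4 * u) = - (3 * u) + - u by ring.
rewrite expRD mulrA ler_piMl ?expR_ge0// expRN ler_pdivrMr ?expR_gt0// mul1r.
by have := expR_ge1Dx (3 * u); lra.
Qed.

Lemma normal_prob_sqr_le (R : realType) (m s : R) : 0 < s ->
  (\int[normal_prob m s]_x ((x - m) ^+ 2)%:E <= (8 * s ^+ 2)%:E)%E.
Proof.
move=> s0.
have mf : measurable_fun [set: R] (fun x : R => (x - m) ^+ 2).
  by apply: measurable_funX; apply: measurable_funB.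
rewrite ge0_integral_normal_prob; first last.
- by move=> x; rewrite lee_fin sqr_ge0.
- exact/measurable_EFinP.
apply: (@le_trans _ _ (\int[lebesgue_measure]_x
    ((8 * s ^+ 2)%:E * (normal_pdf m (2 * s) x)%:E))%E).
  apply: ge0_le_integral => //=.
  - by move=> x _; rewrite -EFinM lee_fin mulr_ge0 ?sqr_ge0 ?normal_pdf_ge0.
  - by apply/measurable_EFinP/measurable_funM => //; exact: measurable_normal_pdf.
  - by apply/measurable_EFinP/measurable_funM => //; exact: measurable_normal_pdf.
  - by move=> x _; rewrite -!EFinM lee_fin normal_pdf_sqr_le.
rewrite ge0_integralZl//; first by rewrite integral_normal_pdf mule1.
- by apply/measurable_EFinP; exact: measurable_normal_pdf.
- by move=> x _; rewrite lee_fin normal_pdf_ge0.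
- by rewrite lee_fin mulr_ge0 ?sqr_ge0.
Qed.

(** The density is at most 1/(2s), because 2 pi >= 4, and the ball has length s.
    This sup bound is insensitive to the position of the mean, and so applies to
    a ball about 0 rather than about m. *)
Lemma normal_prob_small_ball (R : realType) (m s : R) : 0 < s ->
  (normal_prob m s `](- (s / 2))%R, (s / 2)%R[%classic <= 2^-1%:E)%E.
Proof.
move=> s0.
have pb : normal_peak s <= (2 * s)^-1.
  rewrite /normal_peak lef_pV2 ?posrE ?mulr_gt0 ?sqrtr_gt0 ?mulrn_wgt0
    ?mulr_gt0 ?exprn_gt0 ?pi_gt0//.
  rewrite -(@ger0_norm _ (2 * s)) ?mulr_ge0 ?(ltW s0)// -sqrtr_sqr ler_wsqrtr//.
  rewrite exprMn -mulr_natl.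
  have := pi_ge2 R; have : 0 < s ^+ 2 by rewrite exprn_gt0.
  by nra.
apply: (@le_trans _ _
  (\int[lebesgue_measure]_(x in `](- (s / 2))%R, (s / 2)%R[) (cst (2 * s)^-1%:E x))%E).
  apply: ge0_le_integral => //.
  - by move=> x _; rewrite lee_fin normal_pdf_ge0.
  - by apply/measurable_funTS/measurable_EFinP; exact: measurable_normal_pdf.
  - by move=> x _; rewrite lee_fin (le_trans (normal_pdf_ub _ _ _))// gt_eqF.
rewrite integral_cst//= lebesgue_measure_itv/= lte_fin ifT; last by lra.
by rewrite -EFinD -EFinM lee_fin le_eqVlt; apply/orP; left; apply/eqP; field; rewrite gt_eqF.
Qed.

(** The two quantitative features of a Gaussian law from which everything else
    follows, stated so that the point mass (s = 0) needs no separate treatment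
    afterwards. *)
Lemma gaussian_var_spread (dT : measure_display) (T : measurableType dT)
    (R : realType) (P : probability T R) (Z : T -> R) : gaussian_var P Z ->
  exists m s : R, [/\ 0 <= s,
    (\int[P]_w ((Z w - m) ^+ 2)%:E <= (8 * s ^+ 2)%:E)%E &
    (P [set w | (`|Z w| < s / 2)%R] <= 2^-1%:E)%E].
Proof.
move=> [mZ [m [s [s0 lawZ]]]]; exists m, s.
have transfer (nu : {measure set (measurableTypeR R) -> \bar R}) :
    (forall A : set R, measurable A -> P (Z @^-1` A) = nu A) ->
    (\int[P]_w ((Z w - m) ^+ 2)%:E = \int[nu]_x ((x - m) ^+ 2)%:E)%E.
  move=> PZ; pose Z' : T -> measurableTypeR R := Z.
  pose g (x : measurableTypeR R) : \bar R := ((x - m) ^+ 2)%:E.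
  have mg : measurable_fun setT g.
    apply/measurable_EFinP; apply: measurable_funX.
    exact: measurable_funB.
  have mZ' : measurable_fun setT Z' by [].
  have := ge0_integral_pushforward mZ' P measurableT mg
    (fun x _ => sqr_ge0 (x - m) : (0 <= g x)%E).
  rewrite preimage_setT => <-.
  by apply: eq_measure_integral => A mA _; exact: PZ.
have ball : [set w | (`|Z w| < s / 2)%R] = Z @^-1` `](- (s / 2))%R, (s / 2)%R[.
  by apply/seteqP; split => w /=; rewrite in_itv/= -ltr_norml.
split => //; rewrite ?ball.
  have [s00|sn0] := eqVneq s 0.
    rewrite (transfer (\d_(m : measurableTypeR R))); last first.
      by move=> A mA; rewrite lawZ// /gaussian_law s00 eqxx.
    rewrite integral_dirac//.
      by rewrite diracT mul1e subrr expr0n/= s00 expr0n mulr0.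
    apply/measurable_EFinP; apply: measurable_funX.
    exact: measurable_funB.
  rewrite (transfer (normal_prob m s)); last first.
    by move=> A mA; rewrite lawZ// /gaussian_law (negbTE sn0).
  by apply: normal_prob_sqr_le; rewrite lt_neqAle eq_sym sn0.
rewrite lawZ// /gaussian_law; have [->|sn0] := eqVneq s 0.
  rewrite mul0r oppr0 set_itvoo0 measure0 lee_fin//.
by apply: normal_prob_small_ball; rewrite lt_neqAle eq_sym sn0.
Qed.

(** The second moment about a point m is smallest when m is the mean.  Here m is
    the location parameter of the Gaussian law, which is thus never compared
    with the mean 0. *)
Lemma centered_second_moment_le (dT : measure_display) (T : measurableType dT)
    (R : realType) (P : probability T R) (Z : T -> R) (m b : R) :
  measurable_fun setT Z -> ('E_P[Z] = 0)%E ->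
  (\int[P]_w ((Z w - m) ^+ 2)%:E <= b%:E)%E ->
  (\int[P]_w (Z w ^+ 2)%:E <= b%:E)%E.
Proof.
move=> mZ EZ0 dev.
have mD : measurable_fun setT (fun w => (Z w - m) ^+ 2).
  by apply: measurable_funX; apply: measurable_funB.
have iD : P.-integrable setT (EFin \o (fun w => (Z w - m) ^+ 2)).
  apply/integrableP; split; first exact/measurable_EFinP.
  under eq_integral do rewrite /= ger0_norm ?sqr_ge0//.
  by rewrite (le_lt_trans dev)// ltry.
have ic k : P.-integrable setT (EFin \o cst k) by exact: finite_measure_integrable_cst.
have iZ : P.-integrable setT (EFin \o Z).
  apply: (@le_integrable _ _ _ P setT measurableT _
     (EFin \o (fun w => (Z w - m) ^+ 2 + (`|m| + 1)))) => //.
  - exact/measurable_EFinP.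
  - move=> w _ /=; rewrite lee_fin [leRHS]ger0_norm; last first.
      by rewrite addr_ge0 ?sqr_ge0// addr_ge0.
    have : `|Z w| <= `|Z w - m| + `|m| by rewrite -{1}(subrK m (Z w)) ler_normD.
    rewrite -[(Z w - m) ^+ 2]real_normK ?num_real//.
    by have := sqr_ge0 (`|Z w - m| - 1); nra.
  - exact: (integrableD measurableT iD (ic (`|m| + 1))).
have -> : (\int[P]_w (Z w ^+ 2)%:E =
    \int[P]_w (((Z w - m) ^+ 2 - m ^+ 2)%:E + (2 * m)%:E * (Z w)%:E))%E.
  by apply: eq_integral => w _; rewrite -EFinM -EFinD; congr EFin; ring.
rewrite integralD//=; first last.
- exact: (integrableZl measurableT (2 * m) iZ).
- exact: (integrableB measurableT iD (ic (m ^+ 2))).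
rewrite (integralZl measurableT iZ) (_ : (\int[P]_w (Z w)%:E = 0)%E); last first.
  by rewrite -EZ0 unlock.
rewrite mule0 adde0 (le_trans _ dev)//.
apply: le_integral => //; first exact: (integrableB measurableT iD (ic (m ^+ 2))).
by move=> w _; rewrite lee_fin gerBl sqr_ge0.
Qed.

Lemma abs_moment_ge_spread (dT : measure_display) (T : measurableType dT)
    (R : realType) (P : probability T R) (Z : T -> R) (s : R) :
  measurable_fun setT Z -> 0 <= s ->
  (P [set w | (`|Z w| < s / 2)%R] <= 2^-1%:E)%E ->
  ((s / 4)%:E <= \int[P]_w `|Z w|%:E)%E.
Proof.
move=> mZ s0 Ps.
have mN : measurable_fun setT (fun w => `|Z w|) by exact: measurableT_comp.
set B := [set w | _] in Ps.
have mB : measurable B.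
  rewrite -[B]setTI (_ : B = (fun w => `|Z w|) @^-1` `]-oo, (s / 2)[).
    exact: mN.
  by apply/seteqP; split => w /=; rewrite in_itv.
apply: (@le_trans _ _ (\int[P]_(w in ~` B) (cst (s / 2)%:E w))%E).
  rewrite integral_cst//=; last exact: measurableC.
  rewrite probability_setC//.
  apply: (@le_trans _ _ ((s / 2)%:E * 2^-1%:E)%E).
    by rewrite -EFinM lee_fin; lra.
  rewrite lee_wpmul2l ?lee_fin ?divr_ge0//.
  rewrite lee_suber_addr// ?fin_num_measure//.
  apply: (le_trans (leeD2l _ Ps)).
  by rewrite -EFinD lee_fin; lra.
apply: (@le_trans _ _ (\int[P]_(w in ~` B) `|Z w|%:E)%E).
  apply: ge0_le_integral => //; first exact: measurableC.
  - by move=> w _; rewrite lee_fin divr_ge0.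
  - by apply/measurable_funTS/measurable_EFinP.
  - by move=> w /= /negP; rewrite lee_fin -leNgt.
apply: ge0_subset_integral => //; first exact: measurableC.
exact/measurable_EFinP.
Qed.

(** With s the scale, l^2 <= E[Z^2] <= 8 s^2 gives l <= 3s, and
    E|Z| >= s/4 >= l/12. *)
Lemma gaussian_abs_moment_ge (dT : measure_display) (T : measurableType dT)
    (R : realType) (P : probability T R) (Z : T -> R) (l : R) :
  gaussian_var P Z -> ('E_P[Z] = 0)%E ->
  ((l ^+ 2)%:E <= \int[P]_w (Z w ^+ 2)%:E)%E ->
  ((l / 12)%:E <= \int[P]_w `|Z w|%:E)%E.
Proof.
move=> gZ EZ0 l2; have mZ := gZ.1.
have [m [s [s0 dev ball]]] := gaussian_var_spread gZ.
have := le_trans l2 (centered_second_moment_le mZ EZ0 dev); rewrite lee_fin => ls.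
apply: le_trans (abs_moment_ge_spread mZ s0 ball); rewrite lee_fin.
have : l <= 3 * s.
  apply: contraTT ls; rewrite -!ltNge => h; nra.
lra.
Qed.

(** Integrate the pointwise inequality |Z| <= (Z^2/b + b)/2. *)
Lemma abs_moment_le (dT : measure_display) (T : measurableType dT)
    (R : realType) (P : probability T R) (Z : T -> R) (b : R) :
  measurable_fun setT Z -> 0 < b ->
  (\int[P]_w (Z w ^+ 2)%:E <= (b ^+ 2)%:E)%E ->
  (\int[P]_w `|Z w|%:E <= b%:E)%E.
Proof.
move=> mZ b0 Zb.
apply: (@le_trans _ _ (\int[P]_w ((2 * b)^-1%:E * (Z w ^+ 2)%:E + cst (b / 2)%:E w))%E).
  apply: ge0_le_integral => //.
  - by apply/measurable_EFinP; exact: measurableT_comp.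
  - apply: emeasurable_funD => //; apply/measurable_EFinP.
    by apply: measurable_funM => //; exact: measurable_funX.
  - move=> w _; rewrite -EFinM -EFinD lee_fin.
    rewrite -[Z w ^+ 2]real_normK ?num_real//.
    rewrite -subr_ge0.
    have -> : (2 * b)^-1 * `|Z w| ^+ 2 + b / 2 - `|Z w| = (2 * b)^-1 * (`|Z w| - b) ^+ 2.
      by field; rewrite gt_eqF.
    by rewrite mulr_ge0 ?sqr_ge0// invr_ge0 mulr_ge0// ltW.
rewrite ge0_integralD//; first last.
- by move=> w _; rewrite lee_fin divr_ge0// ltW.
- by apply/measurable_EFinP/measurable_funM => //; exact: measurable_funX.
- by move=> w _; rewrite lee_fin mulr_ge0 ?sqr_ge0// invr_ge0 mulr_ge0// ltW.
rewrite integral_cst//= probability_setT mule1 ge0_integralZl//; first last.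
- by rewrite lee_fin invr_ge0 mulr_ge0// ltW.
- by move=> w _; rewrite lee_fin sqr_ge0.
- by apply/measurable_EFinP; exact: measurable_funX.
apply: (@le_trans _ _ ((2 * b)^-1%:E * (b ^+ 2)%:E + (b / 2)%:E)%E).
  by rewrite leeD2r// lee_wpmul2l// lee_fin invr_ge0 mulr_ge0// ltW.
rewrite -EFinM -EFinD lee_fin le_eqVlt; apply/orP; left; apply/eqP.
by field; rewrite gt_eqF.
Qed.

(** * Decay integrals over R^d *)

Lemma powRN_cvg0 (R : realType) (a : R) : 0 < a ->
  t `^ (- a) @[t --> +oo%R] --> (0 : R).
Proof.
move=> a0; apply/cvgrPdist_le => e e0; near=> t.
have t0 : 0 < t by near: t; exact: nbhs_pinfty_gt.
rewrite sub0r normrN ger0_norm ?powR_ge0// powRN invf_ple ?posrE ?powR_gt0//.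
have -> : e^-1 = (e^-1 `^ a^-1) `^ a.
  by rewrite -powRrM mulVf ?gt_eqF// powRr1// invr_ge0 ltW.
by apply: ge0_ler_powR; rewrite ?nnegrE ?(ltW a0) ?powR_ge0 ?(ltW t0)//.
Unshelve. all: by end_near. Qed.

(** An antiderivative on the half-line is a multiple of (t/sigma + 1)^(1-p),
    which vanishes at infinity since p > 1. *)
Lemma integral_powR_decay (R : realType) (p sigma : R) : 1 < p -> 0 < sigma ->
  (\int[lebesgue_measure]_t ((`|t| / sigma + 1) `^ (- p))%:E =
   (2 * sigma / (p - 1))%:E :> \bar R)%E.
Proof.
move=> p1 s0.
pose f (t : R) := (`|t| / sigma + 1) `^ (- p).
have b0 (t : R) : 0 < `|t| / sigma + 1 by rewrite ltr_wpDl// divr_ge0// ltW.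
have cf : continuous f.
  move=> t; apply: (@continuous_comp _ _ _ (fun t => `|t| / sigma + 1) (fun y => y `^ (- p))).
    apply: cvgD; last exact: cvg_cst.
    apply: cvgMl; exact: norm_continuous.
  apply/differentiable_continuous/derivable1_diffP.
  by apply: derivable_powR; rewrite in_itv/= b0.
rewrite (@ge0_symfun_integralT _ f)//; first last.
- by move=> t; rewrite /f/= normrN.
- by move=> t; exact: powR_ge0.
pose F (t : R) := - (sigma / (p - 1)) * (t / sigma + 1) `^ (1 - p).
have u0 (t : R) : 0 <= t -> 0 < t / sigma + 1 by move=> t0; rewrite ltr_wpDl// divr_ge0// ltW.
have dF (t : R) : 0 <= t -> is_derive t 1 F (f t).
  move=> t0.
  have d1 : is_derive (t / sigma + 1) 1 (fun y : R => y `^ (1 - p))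
      ((1 - p) * (t / sigma + 1) `^ (- p)).
    apply: DeriveDef.
      by apply: derivable_powR; rewrite in_itv/= u0.
    rewrite -derive1E powR_derive1 ?in_itv/= ?andbT ?u0//.
    by congr (_ * _ `^ _); ring.
  have d2 : is_derive t 1 (fun t : R => t / sigma + 1) sigma^-1.
    by apply: is_derive_eq; rewrite /GRing.scale/=; ring.
  have d3 := @is_derive1_comp R (fun y : R => y `^ (1 - p))
    (fun t : R => t / sigma + 1) t _ _ d1 d2.
  have := is_deriveZ (- (sigma / (p - 1))) d3.
  suff -> : - (sigma / (p - 1)) *: ((1 - p) * (t / sigma + 1) `^ (- p) / sigma) = f t by [].
  rewrite /f ger0_norm// /GRing.scale/=.
  set u := _ `^ (- p).
  have sn : sigma != 0 by rewrite gt_eqF.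
  have pn : p - 1 != 0 by rewrite gt_eqF// subr_gt0.
  by field; rewrite sn pn.
have half : (\int[lebesgue_measure]_(t in [set t : R | (0 <= t)%R]) (f t)%:E =
    (sigma / (p - 1))%:E)%E.
  rewrite -set_itvcy (@ge0_continuous_FTC2y _ f F 0 0)//.
  - by rewrite sub0e /F mul0r add0r powR1 mulr1 -EFinN opprK.
  - by move=> t _; exact: powR_ge0.
  - by apply: continuous_subspaceT.
  - rewrite -[X in _ --> X](mulr0 (- (sigma / (p - 1)))); apply: cvgMr.
    have -> : (fun t => (t / sigma + 1) `^ (1 - p)) =
        (fun y => y `^ (- (p - 1))) \o (fun t => t / sigma + 1).
      by apply/funext => t /=; rewrite opprB.
    apply: cvg_comp; last by apply: powRN_cvg0; rewrite subr_gt0.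
    apply: (@cvg_comp _ _ _ (fun t => t / sigma) (fun t => t + 1)).
      by apply: gt0_cvgMly; [rewrite invr_gt0|exact: cvg_id].
    exact: cvg_addrr.
  - by move=> t t0; have [] := dF t (ltW t0).
  - apply: cvg_at_right_filter; apply: differentiable_continuous.
    by apply/derivable1_diffP; have [] := dF 0 (lexx 0).
  - move=> t; rewrite in_itv/= andbT => t0.
    by rewrite derive1E; have [_ ->] := dF t (ltW t0).
by rewrite half -EFinM mulrA.
Qed.

Lemma powRN_le (R : realType) (a b q : R) : 0 < a -> a <= b -> 0 <= q ->
  b `^ (- q) <= a `^ (- q).
Proof.
move=> a0 ab q0; have b0 := lt_le_trans a0 ab.
rewrite !powRN lef_pV2 ?posrE ?powR_gt0//.
by apply: ge0_ler_powR; rewrite ?nnegrE ?(ltW a0) ?(ltW b0).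
Qed.

Lemma ge0_integral_lebesgue_tuple_cons (R : realType) (n : nat)
    (f : n.+1.-tuple R -> \bar R) :
  measurable_fun setT f -> (forall x, 0 <= f x)%E ->
  (\int[lebesgue_measure_tuple n.+1]_x f x =
   \int[lebesgue_measure]_t \int[lebesgue_measure_tuple n]_x f (tcons (t, x)))%E.
Proof.
move=> mf f0.
have := ge0_integral_pushforward (@measurable_tcons R n)
  (@lebesgue_measure R \x lebesgue_measure_tuple n)%E measurableT mf (fun x _ => f0 x).
rewrite preimage_setT fubini_tonelli1//.
  by apply: measurableT_comp => //; exact: measurable_tcons.
by move=> x; exact: f0.
Qed.

Lemma integral_tuple_prod (R : realType) (d : nat) (h : R -> R) (I : R) :
  measurable_fun setT h -> (forall t, 0 <= h t) ->
  (\int[lebesgue_measure]_t (h t)%:E = I%:E)%E ->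
  (\int[lebesgue_measure_tuple d]_x (\prod_(i < d) h (tnth x i))%:E =
   (I ^+ d)%:E)%E.
Proof.
move=> mh h0 hI.
have mprod n : measurable_fun [set: n.-tuple R]
    (fun x => (\prod_(i < n) h (tnth x i))%:E).
  apply/measurable_EFinP; apply: measurable_prod => i _.
  by apply: measurableT_comp => //; exact: measurable_tnth.
have prod0 n (x : n.-tuple R) : (0 <= (\prod_(i < n) h (tnth x i))%:E)%E.
  by rewrite lee_fin prodr_ge0.
elim: d => [|d IH].
  rewrite /= integral_dirac//; last exact (mprod 0%N).
  by rewrite diracT mul1e big_ord0 expr0.
have I0 : (0 <= I%:E)%E by rewrite -hI integral_ge0// => t _; rewrite lee_fin.
rewrite ge0_integral_lebesgue_tuple_cons//.
have slice t : (\int[lebesgue_measure_tuple d]_x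
    (\prod_(i < d.+1) h (tnth (tcons (t, x)) i))%:E = (I ^+ d)%:E * (h t)%:E)%E.
  rewrite muleC -IH -ge0_integralZl//.
    apply: eq_integral => x _; rewrite big_ord_recl EFinM; congr (_%:E * _%:E)%E.
    by apply: eq_bigr => i _; rewrite tnthS.
    exact: mprod.
  by rewrite lee_fin.
under eq_integral => t _ do rewrite slice.
rewrite ge0_integralZl//.
- by rewrite hI -EFinM exprSr.
- exact/measurable_EFinP.
- by move=> t _; rewrite lee_fin.
- by rewrite lee_fin exprn_ge0.
Qed.

Section enorm_facts.
Context {R : realType} {d : nat}.
Implicit Types x y : d.-tuple R.

Lemma enorm_ge0 x : 0 <= enorm x. Proof. exact: sqrtr_ge0. Qed.

Lemma norm_tnth_le_enorm x i : `|tnth x i| <= enorm x.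
Proof.
rewrite -sqrtr_sqr ler_wsqrtr// (bigD1 i)//= lerDl.
by apply: sumr_ge0 => j _; rewrite sqr_ge0.
Qed.

Lemma sqr_sum_le_sum_sqr (I : Type) (r : seq I) (a : I -> R) :
  (forall i, 0 <= a i) -> \sum_(i <- r) a i ^+ 2 <= (\sum_(i <- r) a i) ^+ 2.
Proof.
move=> a0; elim: r => [|i r IH]; first by rewrite !big_nil expr0n.
rewrite !big_cons sqrrD -addrA lerD2l (le_trans IH)// lerDr.
by rewrite mulrn_wge0// mulr_ge0// sumr_ge0.
Qed.

Lemma enorm_le_sum x : enorm x <= \sum_(i < d) `|tnth x i|.
Proof.
rewrite -[leRHS]ger0_norm ?sumr_ge0// -sqrtr_sqr ler_wsqrtr//.
under eq_bigr do rewrite -real_normK ?num_real//.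
exact: sqr_sum_le_sum_sqr.
Qed.

Lemma enorm_le_bound x (b : R) : (forall i, `|tnth x i| <= b) ->
  enorm x <= d%:R * b.
Proof.
move=> xb; rewrite (le_trans (enorm_le_sum x))//.
by rewrite (le_trans (ler_sum _ (fun i _ => xb i)))// sumr_const card_ord mulr_natl.
Qed.

(** The triangle inequality with a spurious factor d, proved coordinatewise: only
    orders of magnitude matter, so the Cauchy-Schwarz inequality is avoided. *)
Lemma enorm_vsub_le x y : enorm (vsub x y) <= d%:R * (enorm x + enorm y).
Proof.
apply: enorm_le_bound => i; rewrite tnth_mktuple (le_trans (ler_normB _ _))//.
by rewrite lerD ?norm_tnth_le_enorm.
Qed.

Lemma enorm_le_vsub x y : enorm x <= d%:R * (enorm (vsub x y) + enorm y).
Proof.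
apply: enorm_le_bound => i.
rewrite -(subrK (tnth y i) (tnth x i)) (le_trans (ler_normD _ _))//.
rewrite lerD ?norm_tnth_le_enorm//.
by have := norm_tnth_le_enorm (vsub x y) i; rewrite tnth_mktuple.
Qed.

Lemma measurable_enorm : measurable_fun setT (@enorm R d).
Proof.
have msqrt : measurable_fun [set: R] (@Num.sqrt R).
  by apply: continuous_measurable_fun; exact: sqrt_continuous.
apply: (measurableT_comp msqrt).
apply: measurable_sum => i; apply: measurable_funX.
exact: measurable_tnth.
Qed.

End enorm_facts.

(** Distribute the exponent q as q/d > 1 over the d coordinates and use
    |x_i| <= |x|; the resulting product of one-dimensional integrals carries the
    scaling sigma^d. *)
Lemma integral_enorm_decay (R : realType) (d : nat) (q : R) :
  (1 <= d)%N -> d%:R < q ->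
  exists2 K : R, 0 <= K & forall sigma : R, 0 < sigma ->
    (\int[lebesgue_measure_tuple d]_x ((enorm x / sigma + 1) `^ (- q))%:E
     <= (K * sigma ^+ d)%:E)%E.
Proof.
move=> d1 dq; have d0 : 0 < d%:R :> R by rewrite ltr0n.
have p1 : 1 < q / d%:R by rewrite ltr_pdivlMr// mul1r.
exists ((2 / (q / d%:R - 1)) ^+ d) => [|sigma s0].
  by rewrite exprn_ge0// divr_ge0// subr_ge0 ltW.
have q0 : 0 < q by rewrite (lt_trans d0).
rewrite -exprMn mulrAC.
have mbase : measurable_fun [set: R] (fun t : R => (`|t| / sigma + 1) `^ (- (q / d%:R))).
  apply: (measurableT_comp (measurable_powR _)).
  by apply: measurable_funD => //; exact: measurable_funM.
rewrite -(integral_tuple_prod d mbase) => [|t|]; first last.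
- exact: integral_powR_decay.
- exact: powR_ge0.
apply: ge0_le_integral => //.
- by move=> x _; rewrite lee_fin powR_ge0.
- apply/measurable_EFinP; apply: (measurableT_comp (measurable_powR _)).
  apply: measurable_funD => //; apply: measurable_funM => //.
  exact: measurable_enorm.
- apply/measurable_EFinP; apply: measurable_prod => i _.
  by apply: (measurableT_comp mbase); exact: measurable_tnth.
move=> x _; rewrite lee_fin.
have -> : (enorm x / sigma + 1) `^ (- q) =
    \prod_(i < d) (enorm x / sigma + 1) `^ (- (q / d%:R)).
  rewrite prodr_const card_ord -powR_mulrn ?powR_ge0// -powRrM.
  by rewrite mulNr divfK// gt_eqF.
apply: ler_prod => i _; rewrite powR_ge0/=; apply: powRN_le.
- by rewrite ltr_wpDl// divr_ge0// ltW.
- rewrite lerD2r ler_pM2r ?invr_gt0//; exact: norm_tnth_le_enorm.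
- by rewrite divr_ge0// ltW.
Qed.

Definition cube {R : realType} (d : nat) (sigma : R) : set (d.-tuple R) :=
  [set x | forall i, tnth x i \in `[0, sigma]].
Arguments cube {R} d sigma.

Lemma measurable_cube (R : realType) (d : nat) (sigma : R) :
  measurable (cube d sigma).
Proof.
rewrite (_ : cube d sigma =
    \bigcap_(i in [set: 'I_d]) ((fun x => tnth x i) @^-1` `[0, sigma])).
  apply: fin_bigcap_measurable => [|i _]; first exact: finite_finset.
  by rewrite -[X in measurable X]setTI; apply: measurable_tnth.
by apply/seteqP; split=> x /= h i => [_|]; exact: h.
Qed.

Lemma enorm_cube_le (R : realType) (d : nat) (sigma : R) (x : d.-tuple R) :
  cube d sigma x -> enorm x <= d%:R * sigma.
Proof.
move=> xs; apply: enorm_le_bound => i.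
by have := xs i; rewrite in_itv/= => /andP[x0 xs']; rewrite ger0_norm.
Qed.

Lemma integral_ge_cube (R : realType) (d : nat) (sigma c : R)
    (g : d.-tuple R -> \bar R) : 0 <= sigma -> 0 <= c ->
  measurable_fun setT g -> (forall x, 0 <= g x)%E ->
  (forall x, cube d sigma x -> (c%:E <= g x)%E) ->
  ((c * sigma ^+ d)%:E <= \int[lebesgue_measure_tuple d]_x g x)%E.
Proof.
move=> s0 c0 mg g0 gc; have mQ := @measurable_cube R d sigma.
have Qd : lebesgue_measure_tuple d (cube d sigma) = (sigma ^+ d)%:E.
  rewrite [LHS](@lebesgue_measure_tuple_box R d (fun=> `[0, sigma]%classic))//.
  under eq_bigr => i _ do rewrite lebesgue_measure_itv/= lte_fin oppr0 adde0.
  have -> : (if (0 < sigma)%R then sigma%:E else 0)%E = sigma%:E.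
    by move: s0; rewrite le_eqVlt => /orP[/eqP <-|->//]; rewrite ltxx.
  by rewrite prodEFin prodr_const card_ord.
apply: (@le_trans _ _ (\int[lebesgue_measure_tuple d]_(x in cube d sigma) cst c%:E x)%E).
  by rewrite integral_cst//= Qd EFinM.
apply: (@le_trans _ _ (\int[lebesgue_measure_tuple d]_(x in cube d sigma) g x)%E).
  by apply: ge0_le_integral => //; exact: measurable_funTS.
by apply: ge0_subset_integral.
Qed.

Lemma density_const_gt0 (R : realType) (d : nat) (rho : R) :
  (1 <= d)%N -> d%:R < rho -> 0 < density_const d rho.
Proof.
move=> d1 drho; have [K K0 /(_ 1 ltr01)] := integral_enorm_decay d1 drho.
under eq_integral do rewrite divr1.
rewrite expr1n mulr1 => fin.
have mg : measurable_fun [set: d.-tuple R] (fun x => ((enorm x + 1) `^ (- rho))%:E).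
  apply/measurable_EFinP; apply: (measurableT_comp (measurable_powR _)).
  by apply: measurable_funD => //; exact: measurable_enorm.
have rho0 : 0 <= rho by rewrite (le_trans _ (ltW drho)).
have low := @integral_ge_cube R d 1 ((d%:R + 1) `^ (- rho)) _ ler01
  (powR_ge0 _ _) mg (fun x => powR_ge0 _ _ : (0 <= _%:E)%E).
rewrite /density_const invr_gt0 /Rintegral fine_gt0//.
apply/andP; split; last by rewrite (le_lt_trans fin)// ltry.
apply: (lt_le_trans _ (low _)); first by rewrite expr1n mulr1 lte_fin powR_gt0// ltr_wpDl.
move=> x /enorm_cube_le; rewrite mulr1 lee_fin => xd.
by apply: powRN_le => //; rewrite ?lerD2r// ltr_wpDl// enorm_ge0.
Qed.

(** * The smoothing density and the coupling *)

(** Peetre's inequality: |x|/sigma + 1 is at most d times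
    (|x-a|/sigma + 1)(|a| + 1) as soon as sigma >= 1, so that the translation
    by a costs only a power of |a| + 1. *)
Lemma smoothing_density_le (R : realType) (d : nat) (rho q sigma : R)
    (x a : d.-tuple R) : (1 <= d)%N -> 1 <= sigma -> 0 <= q <= rho ->
  0 <= density_const d rho ->
  smoothing_density rho sigma (vsub x a) <=
  sigma ^- d * density_const d rho * (d%:R `^ q) *
    (enorm x / sigma + 1) `^ (- q) * (enorm a + 1) `^ q.
Proof.
move=> d1 s1 /andP[q0 qrho] C0; have s0 : 0 < sigma by exact: lt_le_trans s1.
have D1 : 1 <= d%:R :> R by rewrite ler1n.
rewrite /smoothing_density -!(mulrA (_ * density_const _ _)) ler_wpM2l//.
  by rewrite mulr_ge0// invr_ge0 exprn_ge0// ltW.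
set u := enorm (vsub x a) / sigma; set v := enorm x / sigma; set b := enorm a.
have u0 : 0 <= u by rewrite divr_ge0 ?enorm_ge0 ?ltW.
have v0 : 0 <= v by rewrite divr_ge0 ?enorm_ge0 ?ltW.
have b0 : 0 <= b by exact: enorm_ge0.
have peetre : v + 1 <= d%:R * ((u + 1) * (b + 1)).
  have vE : v <= d%:R * (u + b).
    rewrite /v ler_pdivrMr// (le_trans (enorm_le_vsub x a))// -mulrA ler_wpM2l//.
    rewrite mulrDl divfK ?gt_eqF// lerD2l -/b; nra.
  have : 0 <= u * b by rewrite mulr_ge0.
  nra.
apply: (@le_trans _ _ ((u + 1) `^ (- q))).
  by apply: ler_powR; rewrite ?lerN2// lerDr.
rewrite !powRN.
have vq : 0 < (v + 1) `^ q by rewrite powR_gt0// ltr_wpDl.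
have uq : 0 < (u + 1) `^ q by rewrite powR_gt0// ltr_wpDl.
rewrite mulrAC ler_pdivlMr// mulrC ler_pdivrMr//.
have := @ge0_ler_powR R q q0 (v + 1) (d%:R * ((u + 1) * (b + 1))).
rewrite !nnegrE !mulr_ge0 ?addr_ge0// => /(_ isT isT peetre).
by rewrite !powRM ?mulr_ge0 ?addr_ge0// [_ * (b + 1) `^ q]mulrC mulrA.
Qed.

(** On the cube |x|/sigma <= d and |a|/sigma <= |a|, so the profile of the density
    at x - a is bounded below independently of x and sigma. *)
Lemma smoothing_density_ge (R : realType) (d : nat) (rho sigma : R)
    (x a : d.-tuple R) : 1 <= sigma -> 0 <= rho ->
  0 <= density_const d rho -> cube d sigma x ->
  sigma ^- d * density_const d rho *
    (d%:R * (d%:R + enorm a) + 1) `^ (- rho) <=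
  smoothing_density rho sigma (vsub x a).
Proof.
move=> s1 rho0 C0 xs; have s0 : 0 < sigma by exact: lt_le_trans s1.
rewrite /smoothing_density ler_wpM2l//.
  by rewrite mulr_ge0// invr_ge0 exprn_ge0// ltW.
apply: powRN_le => //.
  by rewrite ltr_wpDl// divr_ge0 ?enorm_ge0// ltW.
rewrite lerD2r ler_pdivrMr// (le_trans (enorm_vsub_le x a))// -mulrA ler_wpM2l//.
rewrite mulrDl lerD ?enorm_cube_le//.
by rewrite ler_peMr ?enorm_ge0.
Qed.

Lemma smoothing_density_ge0 (R : realType) (d : nat) (rho sigma : R)
    (x : d.-tuple R) : 0 <= sigma -> 0 <= density_const d rho ->
  0 <= smoothing_density rho sigma x.
Proof.
by move=> s0 C0; rewrite !mulr_ge0 ?powR_ge0// invr_ge0 exprn_ge0.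
Qed.

Section increment.
Context {dO : measure_display} {Omega : measurableType dO} {R : realType}.
Context {P : probability Omega R} {d : nat}.
Variables X Y : {RV P >-> d.-tuple R}.

Lemma measurable_coordinate (Z : {RV P >-> d.-tuple R}) i :
  measurable_fun setT (fun w => tnth (Z w) i).
Proof.
by apply: (measurableT_comp (measurable_tnth i)); exact: measurable_funPT.
Qed.

Lemma measurable_increment i :
  measurable_fun setT (fun w => tnth (vsub (Y w) (X w)) i).
Proof.
under eq_fun do rewrite tnth_mktuple.
by apply: measurable_funB; exact: measurable_coordinate.
Qed.

Lemma measurable_smoothing_density rho sigma (x : d.-tuple R) :
  measurable_fun setT (fun w => smoothing_density rho sigma (vsub x (X w))).
Proof.
apply: measurable_funM => //; apply: (measurableT_comp (measurable_powR _)).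
apply: measurable_funD => //; apply: measurable_funM => //.
apply: (measurableT_comp measurable_enorm).
apply/measurable_fun_tnthP => i.
rewrite (_ : _ \o _ = fun w => tnth x i - tnth (X w) i).
  by apply: measurable_funB => //; exact: measurable_coordinate.
by apply/funext => w /=; rewrite tnth_mktuple.
Qed.

(** If all these integrals vanished, then Y_i - X_i = 0 almost surely for every i,
    a finite number of conditions, whence X = Y almost surely. *)
Lemma increment_weighted_gt0 (W : Omega -> R) :
  (P [set w | X w = Y w] < 1)%E ->
  measurable_fun setT W -> (forall w, 0 < W w) ->
  exists i, (0 < \int[P]_w (tnth (vsub (Y w) (X w)) i ^+ 2 * W w)%:E)%E.
Proof.
move=> nd mW W0; apply: contrapT => /forallNP all0.
have D0 : {ae P, forall w, forall i, tnth (vsub (Y w) (X w)) i = 0}.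
  apply: filter_forall => i.
  pose g w := (tnth (vsub (Y w) (X w)) i ^+ 2 * W w)%:E.
  have g0 w : (0 <= g w)%E by rewrite lee_fin mulr_ge0 ?sqr_ge0// ltW.
  have mg : measurable_fun setT g.
    by apply/measurable_EFinP/measurable_funM => //;
      apply: measurable_funX; exact: measurable_increment.
  have : (\int[P]_w `|g w| = 0)%E.
    under eq_integral do rewrite gee0_abs//.
    apply/eqP; rewrite eq_le integral_ge0// andbT leNgt; apply/negP; exact: all0.
  move/(ae_eq_integral_abs _ measurableT mg); apply: filterS => w /(_ I) /=.
  move=> [/eqP]; rewrite mulf_eq0 (gt_eqF (W0 w)) orbF sqrf_eq0.
  by move/eqP.
have mE : measurable [set w | X w = Y w].
  rewrite (_ : [set w | X w = Y w] = \bigcap_(i in [set: 'I_d])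
    ((fun w => tnth (vsub (Y w) (X w)) i) @^-1` [set 0])).
    apply: fin_bigcap_measurable => [|i _]; first exact: finite_finset.
    by rewrite -[X in measurable X]setTI; exact: measurable_increment.
  apply/seteqP; split => w /= => [XY i _|h].
    have e : tnth (X w) i = tnth (Y w) i := congr1 (fun t => tnth t i) XY.
    by rewrite /= tnth_mktuple e subrr.
  apply: eq_from_tnth => i; have := h i I; rewrite /= tnth_mktuple.
  by move/eqP; rewrite subr_eq0 => /eqP.
have : P (~` [set w | X w = Y w]) = 0%E.
  apply: measure_negligible; first exact: measurableC.
  apply: negligibleS D0 => w /= XY h; apply: XY.
  apply: eq_from_tnth => i; have := h i; rewrite tnth_mktuple.
  by move/eqP; rewrite subr_eq0 => /eqP.
by rewrite probability_setC// => h; move: nd; rewrite -sube_gt0 h ltxx.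
Qed.

(** Both Y_i - X_i and |X| are controlled by N = |(X,Y)|, so the integrand is at
    most a constant times (N+1)^(2q+2) <= (N+1)^p <= 2^p (N^p + 1). *)
Lemma increment_weighted_moment (p q : R) : (1 <= d)%N ->
  0 <= q -> 2 * q + 2 <= p ->
  ('E_P[fun w => (enorm (cat_tuple (X w) (Y w)) `^ p)%R] < +oo)%E ->
  exists2 A : R, 0 < A & forall i,
    (\int[P]_w (tnth (vsub (Y w) (X w)) i ^+ 2 * ((enorm (X w) + 1) `^ q) ^+ 2)%:E
      <= (A ^+ 2)%:E)%E.
Proof.
move=> d1 q0 qp; rewrite unlock => mom.
have D1 : 1 <= d%:R :> R by rewrite ler1n.
have p0 : 0 <= p by lra.
pose N w := enorm (cat_tuple (X w) (Y w)).
have N0 w : 0 <= N w by exact: enorm_ge0.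
have XN w i : `|tnth (X w) i| <= N w.
  by have := norm_tnth_le_enorm (cat_tuple (X w) (Y w)) (lshift d i); rewrite tnth_lshift.
have YN w i : `|tnth (Y w) i| <= N w.
  by have := norm_tnth_le_enorm (cat_tuple (X w) (Y w)) (rshift d i); rewrite tnth_rshift.
have mN : measurable_fun setT N.
  apply: (measurableT_comp measurable_enorm).
  apply/measurable_fun_tnthP => i; case: (split_ordP i) => j ->.
    rewrite (_ : _ \o _ = fun w => tnth (X w) j); first exact: measurable_coordinate.
    by apply/funext => w /=; rewrite tnth_lshift.
  rewrite (_ : _ \o _ = fun w => tnth (Y w) j); first exact: measurable_coordinate.
  by apply/funext => w /=; rewrite tnth_rshift.
have mNp : measurable_fun setT (fun w => N w `^ p).
  exact: (measurableT_comp (measurable_powR _)).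
pose k : R := 4 * (d%:R `^ q) ^+ 2 * 2 `^ p.
have k0 : 0 <= k by rewrite !mulr_ge0 ?sqr_ge0 ?powR_ge0.
have bound w i : tnth (vsub (Y w) (X w)) i ^+ 2 * ((enorm (X w) + 1) `^ q) ^+ 2
    <= k * (N w `^ p + 1).
  have DN : tnth (vsub (Y w) (X w)) i ^+ 2 <= 4 * (N w + 1) ^+ 2.
    rewrite tnth_mktuple -real_normK ?num_real//.
    have : `|tnth (Y w) i - tnth (X w) i| <= 2 * (N w + 1).
      rewrite (le_trans (ler_normB _ _))//; have := XN w i; have := YN w i; lra.
    have := normr_ge0 (tnth (Y w) i - tnth (X w) i); nra.
  have Xq : ((enorm (X w) + 1) `^ q) ^+ 2 <= (d%:R `^ q) ^+ 2 * ((N w + 1) `^ q) ^+ 2.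
    rewrite -exprMn -powRM// ?addr_ge0//; apply: lerXn2r; rewrite ?nnegrE ?powR_ge0//.
    apply: ge0_ler_powR; rewrite ?nnegrE ?mulr_ge0 ?addr_ge0 ?enorm_ge0//.
    rewrite mulrDr mulr1 lerD//. exact: enorm_le_bound.
  apply: (le_trans (ler_pM _ _ DN Xq)); rewrite ?sqr_ge0//.
  have -> : 4 * (N w + 1) ^+ 2 * ((d%:R `^ q) ^+ 2 * ((N w + 1) `^ q) ^+ 2) =
      4 * (d%:R `^ q) ^+ 2 * (N w + 1) `^ (2 * q + 2).
    rewrite powRD; last by apply/implyP => _; rewrite gt_eqF// ltr_wpDl.
    rewrite [2 * q]mulrC powRrM !powR_mulrn ?powR_ge0 ?addr_ge0//; ring.
  rewrite /k -(mulrA _ (2 `^ p)) ler_wpM2l ?mulr_ge0 ?sqr_ge0//.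
  apply: (@le_trans _ _ ((N w + 1) `^ p)); first by apply: ler_powR; rewrite ?lerDr.
  have [N1|/ltW N1] := leP (N w) 1.
    apply: (@le_trans _ _ (2 `^ p)).
      apply: ge0_ler_powR; rewrite ?nnegrE ?addr_ge0//; lra.
    by rewrite ler_peMr ?powR_ge0// lerDr powR_ge0.
  apply: (@le_trans _ _ ((2 * N w) `^ p)).
    apply: ge0_ler_powR; rewrite ?nnegrE ?addr_ge0 ?mulr_ge0//; lra.
  by rewrite powRM// ler_wpM2l ?powR_ge0// lerDl.
pose M := fine (\int[P]_w (N w `^ p)%:E).
have EM : (\int[P]_w (N w `^ p)%:E)%E = M%:E.
  rewrite fineK// ge0_fin_numE// integral_ge0// => w _.
  by rewrite lee_fin powR_ge0.
have M0 : 0 <= M by apply: fine_ge0; rewrite integral_ge0// => w _; rewrite lee_fin powR_ge0.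
(* k (M + 1) bounds the moment and t <= (t + 1)^2, so no square root is needed *)
exists (k * (M + 1) + 1) => [|i].
  by rewrite ltr_wpDl// mulr_ge0// addr_ge0.
apply: (@le_trans _ _ (\int[P]_w (k%:E * ((N w `^ p)%:E + cst 1 w)))%E).
  apply: ge0_le_integral => //.
  - by move=> w _; rewrite lee_fin mulr_ge0// sqr_ge0.
  - apply/measurable_EFinP; apply: measurable_funM; apply: measurable_funX.
      exact: measurable_increment.
    apply: (measurableT_comp (measurable_powR _)); apply: measurable_funD => //.
    by apply: (measurableT_comp measurable_enorm); exact: measurable_funPT.
  - apply: emeasurable_funM => //; apply: emeasurable_funD => //.
    exact/measurable_EFinP.
  - by move=> w _; rewrite -EFinD -EFinM lee_fin.
rewrite ge0_integralZl//; first last.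
- by move=> w _; rewrite adde_ge0// lee_fin powR_ge0.
- by apply: emeasurable_funD => //; exact/measurable_EFinP.
rewrite ge0_integralD//; first last.
- exact/measurable_EFinP.
- by move=> w _; rewrite lee_fin powR_ge0.
rewrite EM integral_cst//= mul1e probability_setT -EFinD -EFinM lee_fin.
have : 0 <= k * (M + 1) by rewrite mulr_ge0// addr_ge0.
nra.
Qed.

End increment.

(** * First moments of the process *)

Section process.
Context {dT : measure_display} {T : measurableType dT} {R : realType}.
Context {P : probability T R} {d : nat}.
Variable G : d.-tuple R -> T -> d.-tuple R.

(** One coordinate at one time is the linear combination with a basis vector as
    its only coefficient. *)
Lemma gaussian_process_coordinate x i :
  gaussian_process P G -> gaussian_var P (fun w => tnth (G x w) i).
Proof.
move=> gG; pose e : d.-tuple R := [tuple (i == j)%:R | j < d].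
have := gG 1%N (fun=> x) (fun=> e); congr gaussian_var; apply/funext => w.
rewrite big_ord1 (bigD1 i)//= tnth_mktuple eqxx mul1r big1 ?addr0// => j ji.
by rewrite tnth_mktuple eq_sym (negbTE ji) mul0r.
Qed.

Hypothesis mG : measurable_process G.

Let mEG : measurable_fun [set: d.-tuple R * T]
  (fun p => (enorm (G p.1 p.2))%:E).
Proof. by apply/measurable_EFinP; exact: (measurableT_comp measurable_enorm). Qed.

Let EG0 (p : d.-tuple R * T) : (0 <= (enorm (G p.1 p.2))%:E)%E.
Proof. by rewrite lee_fin enorm_ge0. Qed.

Let mGx x : measurable_fun setT (G x).
Proof. exact: (measurableT_comp mG (measurable_pair1 x)). Qed.

Let mGxi x i : measurable_fun setT (fun w => tnth (G x w) i).
Proof. exact: (measurableT_comp (measurable_tnth i)). Qed.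

Let mEGx x : measurable_fun setT (fun w => (enorm (G x w))%:E).
Proof. by apply/measurable_EFinP; exact: (measurableT_comp measurable_enorm). Qed.

Lemma expected_integral_enorm_le (b : d.-tuple R -> R) :
  measurable_fun setT b -> (forall x, 0 < b x) ->
  (forall x i, (\int[P]_w (tnth (G x w) i ^+ 2)%:E <= (b x ^+ 2)%:E)%E) ->
  (\int[P]_w \int[lebesgue_measure_tuple d]_x (enorm (G x w))%:E <=
   \int[lebesgue_measure_tuple d]_x (d%:R * b x)%:E)%E.
Proof.
move=> mb b0 Gb.
rewrite -(@fubini_tonelli _ _ _ _ _ (lebesgue_measure_tuple d) P
  (fun p => (enorm (G p.1 p.2))%:E))//=.
apply: ge0_le_integral => //.
- by move=> x _; apply: integral_ge0 => w _; exact: (EG0 (x, w)).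
- exact: (measurable_fun_fubini_tonelli_F (m2 := P) _ mEG EG0).
- by apply/measurable_EFinP; exact: measurable_funM.
move=> x _.
apply: (@le_trans _ _ (\int[P]_w \sum_(i < d) `|tnth (G x w) i|%:E)%E).
  apply: ge0_le_integral => //.
  - by move=> w _; exact: (EG0 (x, w)).
  - apply: emeasurable_sum => i; apply/measurable_EFinP.
    exact: measurableT_comp.
  - by move=> w _; rewrite sumEFin lee_fin enorm_le_sum.
rewrite ge0_integral_sum//; last first.
  by move=> i; apply/measurable_EFinP; exact: measurableT_comp.
rewrite mulr_natl -[X in (_ *+ X)%R]card_ord -sumr_const -sumEFin.
by apply: lee_sum => i _; exact: abs_moment_le.
Qed.

Lemma expected_integral_enorm_ge (i : 'I_d) (l sigma : R) :
  gaussian_process P G -> centered_process P G -> 0 <= sigma -> 0 <= l ->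
  (forall x, cube d sigma x ->
    ((l ^+ 2)%:E <= \int[P]_w (tnth (G x w) i ^+ 2)%:E)%E) ->
  ((l / 12 * sigma ^+ d)%:E <=
   \int[P]_w \int[lebesgue_measure_tuple d]_x (enorm (G x w))%:E)%E.
Proof.
move=> gG cG s0 l0 lG.
rewrite -(@fubini_tonelli _ _ _ _ _ (lebesgue_measure_tuple d) P
  (fun p => (enorm (G p.1 p.2))%:E))//=.
apply: integral_ge_cube => //; first by rewrite divr_ge0.
- exact: (measurable_fun_fubini_tonelli_F (m2 := P) _ mEG EG0).
- by move=> x; apply: integral_ge0 => w _; exact: (EG0 (x, w)).
move=> x xs.
have := gaussian_abs_moment_ge (gaussian_process_coordinate x i gG) (cG x i) (lG x xs).
move/le_trans; apply; apply: ge0_le_integral => //.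
- by apply/measurable_EFinP; exact: measurableT_comp.
- by move=> w _; rewrite lee_fin norm_tnth_le_enorm.
Qed.

End process.

(** Extracts a real standard deviation from a positive variance without having to
    know that the variance is finite. *)
Lemma sqr_lower_bound (R : realType) (e : \bar R) : (0 < e)%E ->
  exists2 a : R, 0 < a & ((a ^+ 2)%:E <= e)%E.
Proof.
case: e => [r||//]; last by exists 1 => //; rewrite leey.
rewrite lte_fin => r0; exists (Num.sqrt r); first by rewrite sqrtr_gt0.
by rewrite sqr_sqrtr// ltW.
Qed.

Lemma ge0_integral_sqr_scale (dO : measure_display) (Omega : measurableType dO)
    (R : realType) (P : probability Omega R) (c : R) (g : Omega -> R) :
  measurable_fun setT g -> (forall w, 0 <= g w) ->
  (\int[P]_w (c ^+ 2 * g w)%:E = (c ^+ 2)%:E * \int[P]_w (g w)%:E)%E.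
Proof.
move=> mg g0; rewrite -ge0_integralZl//.
- exact/measurable_EFinP.
- by move=> w _; rewrite lee_fin.
- by rewrite lee_fin sqr_ge0.
Qed.

Section covariance.
Context {dO : measure_display} {Omega : measurableType dO} {R : realType}.
Context {P : probability Omega R} {d : nat}.
Variables X Y : {RV P >-> d.-tuple R}.

Let D w i := tnth (vsub (Y w) (X w)) i.

Lemma smoothed_variance_le (rho q sigma A : R) (x : d.-tuple R) (i : 'I_d) :
  (1 <= d)%N -> 1 <= sigma -> 0 <= q <= rho -> 0 <= density_const d rho ->
  (\int[P]_w (D w i ^+ 2 * ((enorm (X w) + 1) `^ q) ^+ 2)%:E <= (A ^+ 2)%:E)%E ->
  (\int[P]_w (D w i ^+ 2 * smoothing_density rho sigma (vsub x (X w)) ^+ 2)%:E <=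
   ((sigma ^- d * density_const d rho * d%:R `^ q * A *
     (enorm x / sigma + 1) `^ (- q)) ^+ 2)%:E)%E.
Proof.
move=> d1 s1 qrho C0 mA; have s0 : 0 <= sigma by rewrite (le_trans _ s1).
have mD := measurable_increment X Y i.
have mw : measurable_fun setT (fun w => D w i ^+ 2 * ((enorm (X w) + 1) `^ q) ^+ 2).
  apply: measurable_funM; apply: measurable_funX => //.
  apply: (measurableT_comp (measurable_powR _)); apply: measurable_funD => //.
  by apply: (measurableT_comp measurable_enorm); exact: measurable_funPT.
set c := sigma ^- d * density_const d rho * d%:R `^ q * (enorm x / sigma + 1) `^ (- q).
apply: (@le_trans _ _ (\int[P]_w (c ^+ 2 *
    (D w i ^+ 2 * ((enorm (X w) + 1) `^ q) ^+ 2))%:E)%E).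
  apply: ge0_le_integral => //.
  - by move=> w _; rewrite lee_fin mulr_ge0// sqr_ge0.
  - apply/measurable_EFinP; apply: measurable_funM; apply: measurable_funX => //.
    exact: measurable_smoothing_density.
  - by apply/measurable_EFinP; exact: measurable_funM.
  - move=> w _; rewrite lee_fin [leRHS]mulrCA ler_wpM2l ?sqr_ge0// -exprMn.
    apply: lerXn2r; rewrite ?nnegrE ?smoothing_density_ge0//.
      by rewrite !mulr_ge0 ?powR_ge0// invr_ge0 exprn_ge0.
    exact: smoothing_density_le.
rewrite ge0_integral_sqr_scale//; last by move=> w; rewrite mulr_ge0 ?sqr_ge0.
apply: (le_trans (lee_wpmul2l _ mA)); first by rewrite lee_fin sqr_ge0.
by rewrite -EFinM lee_fin -exprMn /c mulrAC.
Qed.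

Lemma smoothed_variance_ge (rho sigma a : R) (x : d.-tuple R) (i : 'I_d) :
  1 <= sigma -> 0 <= rho -> 0 <= density_const d rho -> cube d sigma x ->
  ((a ^+ 2)%:E <= \int[P]_w (D w i ^+ 2 *
    ((d%:R * (d%:R + enorm (X w)) + 1) `^ (- rho)) ^+ 2)%:E)%E ->
  (((sigma ^- d * density_const d rho * a) ^+ 2)%:E <=
   \int[P]_w (D w i ^+ 2 * smoothing_density rho sigma (vsub x (X w)) ^+ 2)%:E)%E.
Proof.
move=> s1 rho0 C0 xs ma; have s0 : 0 <= sigma by rewrite (le_trans _ s1).
have mD := measurable_increment X Y i.
have mw : measurable_fun setT (fun w => D w i ^+ 2 *
    ((d%:R * (d%:R + enorm (X w)) + 1) `^ (- rho)) ^+ 2).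
  apply: measurable_funM; apply: measurable_funX => //.
  apply: (measurableT_comp (measurable_powR _)); apply: measurable_funD => //.
  apply: measurable_funM => //; apply: measurable_funD => //.
  by apply: (measurableT_comp measurable_enorm); exact: measurable_funPT.
set c := sigma ^- d * density_const d rho.
have c0 : 0 <= c by rewrite mulr_ge0// invr_ge0 exprn_ge0.
apply: (@le_trans _ _ (\int[P]_w (c ^+ 2 * (D w i ^+ 2 *
    ((d%:R * (d%:R + enorm (X w)) + 1) `^ (- rho)) ^+ 2))%:E)%E).
  rewrite ge0_integral_sqr_scale//; last by move=> w; rewrite mulr_ge0 ?sqr_ge0.
  by rewrite exprMn EFinM; apply: lee_wpmul2l ma; rewrite lee_fin sqr_ge0.
apply: ge0_le_integral => //.
- by move=> w _; rewrite lee_fin; do 2?[apply: mulr_ge0 => //; rewrite ?sqr_ge0//].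
- by apply/measurable_EFinP; exact: measurable_funM.
- apply/measurable_EFinP; apply: measurable_funM; apply: measurable_funX => //.
  exact: measurable_smoothing_density.
- move=> w _; rewrite lee_fin [leLHS]mulrCA ler_wpM2l ?sqr_ge0// -exprMn.
  apply: lerXn2r; rewrite ?nnegrE ?smoothing_density_ge0 ?(mulr_ge0 c0 (powR_ge0 _ _))//.
  exact: smoothing_density_ge.
Qed.

End covariance.

(** * The two-sided bound *)

Theorem theorem3 (R : realType) (d : nat) (hd : (1 <= d)%N)
  (rho : R) (hrho : d%:R + 1 < rho)
  (dO : measure_display) (Omega : measurableType dO) (P0 : probability Omega R)
  (X Y : {RV P0 >-> d.-tuple R})
  (hXY : martingale_coupling P0 X Y)
  (hmom : exists2 delta : R, 0 < delta &
    ('E_P0[fun w => (enorm (cat_tuple (X w) (Y w))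
                     `^ (2 * (d%:R + 1) + delta))%R] < +oo)%E)
  (hnd : (P0 [set w | X w = Y w] < 1)%E)
  (dG : R -> measure_display)
  (OmegaG : forall sigma : R, measurableType (dG sigma))
  (PG : forall sigma : R, probability (OmegaG sigma) R)
  (G : forall sigma : R, d.-tuple R -> OmegaG sigma -> d.-tuple R)
  (hGm : forall sigma : R, 0 < sigma -> measurable_process (G sigma))
  (hGgauss : forall sigma : R, 0 < sigma -> gaussian_process (PG sigma) (G sigma))
  (hGcent : forall sigma : R, 0 < sigma -> centered_process (PG sigma) (G sigma))
  (hGcov : forall sigma : R, 0 < sigma ->
    forall (x y : d.-tuple R) (i j : 'I_d),
      ('E_(PG sigma)[fun w => (tnth (G sigma x w) i * tnth (G sigma y w) j)%R] =
       'E_P0[fun w => (tnth (vsub (Y w) (X w)) i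
                       * smoothing_density rho sigma (vsub x (X w))
                       * smoothing_density rho sigma (vsub y (X w))
                       * tnth (vsub (Y w) (X w)) j)%R])%E) :
  exists2 C : R, 0 < C &
    \forall sigma \near +oo,
      ((C^-1)%:E <=
         \int[PG sigma]_w \int[lebesgue_measure_tuple d]_x
           (enorm (G sigma x w))%:E <= C%:E)%E.
Proof.
have [delta delta0 mom] := hmom.
have [rho0 C0] : 0 < rho /\ 0 < density_const d rho.
  split; first by rewrite (le_lt_trans _ hrho)// addr_ge0.
  by apply: density_const_gt0 => //; rewrite (le_lt_trans _ hrho)// lerDl.
set Crho := density_const d rho in C0.
(* the largest exponent up to rho for which 2q + 2 moments are assumed *)
pose q := Num.min rho (d%:R + delta / 2).
have dq : d%:R < q.
  by rewrite lt_min; apply/andP; split; lra.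
have qrho : 0 <= q <= rho.
  by rewrite (le_trans _ (ltW dq))//= /q ge_min lexx.
have qmom : 2 * q + 2 <= 2 * (d%:R + 1) + delta.
  have : q <= d%:R + delta / 2 by rewrite /q ge_min lexx orbT.
  lra.
have [A A0 mA] := increment_weighted_moment hd (andP qrho).1 qmom mom.
have [K K0 decay] := integral_enorm_decay hd dq.
(* the profile of the density on the cube, uniform in x and sigma, squared *)
pose W w := ((d%:R * (d%:R + enorm (X w)) + 1) `^ (- rho)) ^+ 2.
have mW : measurable_fun setT W.
  apply: measurable_funX; apply: (measurableT_comp (measurable_powR _)).
  apply: measurable_funD => //; apply: measurable_funM => //.
  apply: measurable_funD => //.
  by apply: (measurableT_comp measurable_enorm); exact: measurable_funPT.
have W0 w : 0 < W w.
  by rewrite exprn_gt0// powR_gt0// ltr_wpDl// mulr_ge0// addr_ge0// enorm_ge0.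
have [i /sqr_lower_bound[a a0 la]] := increment_weighted_gt0 hnd mW W0.
pose U := d%:R * (Crho * d%:R `^ q * A) * K.
pose L := Crho * a / 12.
have L0 : 0 < L by rewrite divr_gt0// mulr_gt0.
have U0 : 0 <= U by rewrite !mulr_ge0 ?powR_ge0// ltW.
exists (U + L^-1) => [|]; first by rewrite ltr_wpDl// invr_gt0.
near=> sigma.
have s1 : 1 <= sigma by near: sigma; apply: nbhs_pinfty_ge; rewrite num_real.
have s0 : 0 < sigma by exact: lt_le_trans s1.
have sd : sigma ^+ d != 0 by rewrite expf_neq0// gt_eqF.
have var x j : (\int[PG sigma]_w (tnth (G sigma x w) j ^+ 2)%:E =
    \int[P0]_w (tnth (vsub (Y w) (X w)) j ^+ 2 *
      smoothing_density rho sigma (vsub x (X w)) ^+ 2)%:E)%E.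
  have := hGcov sigma s0 x x j j; rewrite unlock => covE.
  rewrite -[LHS]/(\int[PG sigma]_w
    (tnth (G sigma x w) j * tnth (G sigma x w) j)%:E)%E covE.
  by apply: eq_integral => w _; congr EFin; ring.
apply/andP; split.
  apply: (@le_trans _ _ (sigma ^- d * Crho * a / 12 * sigma ^+ d)%:E).
    rewrite lee_fin.
    have -> : sigma ^- d * Crho * a / 12 * sigma ^+ d = L.
      by rewrite /L; field.
    rewrite -[leRHS]invrK lef_pV2 ?posrE ?ltr_wpDl ?invr_gt0//.
    by rewrite lerDr.
  apply: (expected_integral_enorm_ge (hGm sigma s0) (i := i)) => //.
  - exact: hGgauss.
  - exact: hGcent.
  - by rewrite !mulr_ge0 ?(ltW C0) ?(ltW a0)// invr_ge0 exprn_ge0// ltW.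
  - move=> x xs; rewrite var; exact: (smoothed_variance_ge s1 (ltW rho0) (ltW C0) xs la).
pose k := sigma ^- d * Crho * d%:R `^ q * A.
have k0 : 0 < k.
  by rewrite !mulr_gt0 ?powR_gt0 ?ltr0n// invr_gt0 exprn_gt0.
have e0 (x : d.-tuple R) : 0 < enorm x / sigma + 1.
  by rewrite ltr_wpDl// divr_ge0 ?enorm_ge0// ltW.
have me : measurable_fun setT (fun x : d.-tuple R => (enorm x / sigma + 1) `^ (- q)).
  apply: (measurableT_comp (measurable_powR _)).
  apply: measurable_funD => //; apply: measurable_funM => //.
  exact: measurable_enorm.
apply: (le_trans (expected_integral_enorm_le (hGm sigma s0)
  (b := fun x => k * (enorm x / sigma + 1) `^ (- q)) _ _ _)).
- exact: measurable_funM.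
- by move=> x; rewrite mulr_gt0// powR_gt0.
- move=> x j; rewrite var.
  exact: (smoothed_variance_le x hd s1 qrho (ltW C0) (mA j)).
under eq_integral do rewrite mulrA EFinM.
rewrite ge0_integralZl//; first last.
- by rewrite lee_fin mulr_ge0// ltW.
- by move=> x _; rewrite lee_fin powR_ge0.
- exact/measurable_EFinP.
apply: (le_trans (lee_wpmul2l _ (decay _ s0))).
  by rewrite lee_fin mulr_ge0// ltW.
rewrite -EFinM lee_fin.
have -> : d%:R * k * (K * sigma ^+ d) = U by rewrite /k /U; field.
by rewrite lerDl invr_ge0 ltW.
Unshelve. all: by end_near. Qed.
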